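(* Let $\Sigma=(G,\sigma)$ be a signed graph whose underlying graph $G$ is finite, simple and connected. The following properties are equivalent: (i) $\Sigma$ is balanced. (ii) $D^{\max}(\Sigma)$ is cospectral with $D(G)$. (iii) $D^{\min}(\Sigma)$ is cospectral with $D(G)$. (iv) $D^{\max}(\Sigma)$ has largest eigenvalue equal to that of $D(G)$. (v) $D^{\min}(\Sigma)$ has largest eigenvalue equal to that of $D(G)$. In particular, $\Sigma$ is balanced if and only if $D^{\pm}(\Sigma)$ exists and is cospectral with $D(G)$.
   Context: A signed graph $\Sigma=(G,\sigma)$ consists of an underlying graph $G=(V,E)$ and a signature $\sigma:E\to\{1,-1\}$. The sign of a path or cycle is the product of the signs of its edges. $\Sigma$ is balanced if every cycle of $\Sigma$ has sign $+1$. Let $d(u,v)$ be the usual graph distance in $G$, and let $D(G)=(d(u,v))$ be the usual distance matrix of $G$. For vertices $u,v$, let $\sigma_{\max}(u,v)=-1$ if all shortest $uv$-paths have sign $-1$, and $\sigma_{\max}(u,v)=+1$ otherwise; let $\sigma_{\min}(u,v)=+1$ if all shortest $uv$-paths have sign $+1$, and $\sigma_{\min}(u,v)=-1$ otherwise. Put $d_{\max}(u,v)=\sigma_{\max}(u,v)\,d(u,v)$ and $d_{\min}(u,v)=\sigma_{\min}(u,v)\,d(u,v)$. The signed distance matrices are $D^{\max}(\Sigma)=(d_{\max}(u,v))$ and $D^{\min}(\Sigma)=(d_{\min}(u,v))$. One says $D^{\pm}(\Sigma)$ exists if $D^{\max}(\Sigma)=D^{\min}(\Sigma)$, and then $D^{\pm}(\Sigma)$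 denotes this common matrix. Two matrices are cospectral if they have the same eigenvalues with the same multiplicities. *)

(* Defs.v *)
From HB Require Import structures.
From mathcomp Require Import all_boot all_order all_algebra.
From mathcomp Require Import reals complex.

Set Implicit Arguments.
Unset Strict Implicit.
Unset Printing Implicit Defensive.

Import Order.TTheory GRing.Theory Num.Theory.
Local Open Scope ring_scope.
Local Open Scope complex_scope.

Record sgraph := SGraph {
  vertex :> finType;
  adj : rel vertex;
  adj_sym : symmetric adj;
  adj_irrefl : irreflexive adj
}.

Definition edges (G : sgraph) : {set {set G}} :=
  [set [set e.1; e.2] | e : G * G & adj e.1 e.2].

(* The values of [sign] outside [edges] are unconstrained and never used. *)
Record signed_graph := SignedGraph {
  ugraph :> sgraph;
  sign : {set ugraph} -> int;
  signP : forall e, e \in edges ugraph -> (sign e == 1) || (sign e == -1)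
}.

(* The graph with no vertex is not considered connected. *)
Definition connected_graph (G : sgraph) : Prop :=
  (0 < #|G|)%N /\ forall u v : G, connect (@adj G) u v.

Section Paths.
Variable G : sgraph.

(* The path u = x_0, x_1, ..., x_k = v is represented by p = [:: x_1; ...; x_k],
   so that its length is [size p]. *)
Definition is_path (u v : G) (p : seq G) : bool :=
  [&& path (@adj G) u p, last u p == v & uniq (u :: p)].

(* A path has fewer than #|G| edges; the value is #|G| if there is no path. *)
Definition dist (u v : G) : nat :=
  find (fun k => [exists p : k.-tuple G, is_path u v p]) (iota 0 #|G|).

(* Without the bound on the size, [:: x; y] with x adjacent to y would count
   as a cycle. *)
Definition is_cycle (c : seq G) : bool :=
  (2 < size c)%N && ucycleb (@adj G) c.

End Paths.

Section SignedPaths.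
Variable S : signed_graph.

Definition path_sign (u : S) (p : seq S) : int :=
  \prod_(e <- pairmap (fun x y => [set x; y]) u p) sign e.

Definition cycle_sign (c : seq S) : int :=
  if c is x :: p then path_sign x (rcons p x) else 1.

Definition balanced : Prop :=
  forall c : seq S, is_cycle c -> cycle_sign c = 1.

Definition all_shortest_paths_have_sign (s : int) (u v : S) : bool :=
  [forall p : (dist u v).-tuple S, is_path u v p ==> (path_sign u p == s)].

Definition sigma_max (u v : S) : int :=
  if all_shortest_paths_have_sign (-1) u v then -1 else 1.

Definition sigma_min (u v : S) : int :=
  if all_shortest_paths_have_sign 1 u v then 1 else -1.

Definition d_max (u v : S) : int := sigma_max u v * (dist u v)%:Z.

Definition d_min (u v : S) : int := sigma_min u v * (dist u v)%:Z.

End SignedPaths.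

Section Matrices.
Variable R : realType.

Definition D (G : sgraph) : 'M[R]_#|G| :=
  \matrix_(i, j) (dist (enum_val i) (enum_val j))%:R.

Definition Dmax (S : signed_graph) : 'M[R]_#|S| :=
  \matrix_(i, j) (d_max (enum_val i) (enum_val j))%:~R.

Definition Dmin (S : signed_graph) : 'M[R]_#|S| :=
  \matrix_(i, j) (d_min (enum_val i) (enum_val j))%:~R.

(* [M] is the matrix D^{\pm}(S), which exists iff Dmax S = Dmin S. *)
Definition is_Dpm (S : signed_graph) (M : 'M[R]_#|S|) : Prop :=
  M = Dmax S /\ M = Dmin S.

Section Spectrum.
Variable n : nat.

(* Multiplicity of [z] as a complex eigenvalue; 0 if it is not an eigenvalue. *)
Definition eigen_mult (A : 'M[R]_n) (z : R[i]) : nat :=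
  mup z (char_poly (map_mx (real_complex R) A)).

Definition cospectral (A B : 'M[R]_n) : Prop :=
  forall z : R[i], eigen_mult A z = eigen_mult B z.

(* Real eigenvalues suffice: this is only used for symmetric matrices. *)
Definition largest_eigenvalue (A : 'M[R]_n) (r : R) : Prop :=
  eigenvalue A r /\ forall s : R, eigenvalue A s -> s <= r.

Definition same_largest_eigenvalue (A B : 'M[R]_n) : Prop :=
  exists r : R, largest_eigenvalue A r /\ largest_eigenvalue B r.

End Spectrum.

End Matrices.

(* Main.v *)
Require Import Defs.
From mathcomp Require Import all_boot all_order all_algebra.
From mathcomp Require Import reals complex ring.

(** Two facts carry the proof.

    Combinatorially, a connected signed graph is balanced exactly when it has a
    switching function: signs theta on the vertices such that every edge uv has
    sign theta u * theta v ([balancedP]).  Given theta, every walk from u to v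
    has sign theta u * theta v, so shortest paths never disagree and
    Dmax = Dmin = T D T with T the diagonal matrix of theta.  As T is its own
    inverse, this matrix has the characteristic polynomial of D
    ([balanced_Dpm]).

    Spectrally, let M have entries with |M i j| <= D i j, and let its
    eigenvalue r be the largest eigenvalue of D.  If x is an r-eigenvector of
    M and y = |x|, then
      r |y|^2 = x M x^T <= y D y^T <= r |y|^2,
    the last step being the Rayleigh bound.  Hence y is an r-eigenvector of D
    ([rayleigh_equality]), and its entries do not vanish because D is positive
    off the diagonal.  Equality in x M x^T = y D y^T is then equality term by
    term, which says M i j = sgn x_i * D i j * sgn x_j
    ([max_eigenvalue_signature]).  For Dmax and for Dmin the entry at an edge
    is the sign of that edge, so sgn x is a switching function.

    The two facts close the cycle: balance gives both cospectralities, each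
    cospectrality gives the equality of largest eigenvalues since D, being
    symmetric, has a largest eigenvalue ([cospectral_same_largest]), and each
    such equality gives back balance ([same_largest_balanced]). *)

Set Implicit Arguments.
Unset Strict Implicit.
Unset Printing Implicit Defensive.

Import Order.TTheory GRing.Theory Num.Theory.
Local Open Scope ring_scope.
Local Open Scope complex_scope.
Local Open Scope sesquilinear_scope.

(** * Shortest paths *)

Section ShortestPaths.
Variable G : sgraph.
Implicit Types (u v : G) (p : seq G).

(** The bound #|G| on the search range of [dist] is harmless: a path has no
    repeated vertex, hence fewer than #|G| edges. *)
Lemma dist_le u v p : is_path u v p -> (dist u v <= size p)%N.
Proof.
move=> pP; rewrite leqNgt; apply/negP => lt_d.
have szp : (size p < #|G|)%N.
  by case/and3P: pP => _ _ /card_uniqP; rewrite /= => <-; apply: max_card.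
have /(before_find 0%N) := lt_d; rewrite nth_iota // add0n => /existsP[].
by exists (in_tuple p).
Qed.

Lemma shortest_path_exists u v :
  connect (@adj G) u v -> exists2 p, size p = dist u v & is_path u v p.
Proof.
move=> /connectP[q /shortenP[p pP pU _] def_v] {q}.
have puv : is_path u v p by rewrite /is_path pP -def_v eqxx.
have szp : (size p < #|G|)%N by rewrite -[(size p).+1]/(size (u :: p)) -(card_uniqP pU) max_card.
have lt_d : (dist u v < #|G|)%N by apply: leq_ltn_trans (dist_le puv) szp.
have : has (fun k => [exists q : k.-tuple G, is_path u v q]) (iota 0 #|G|).
  by rewrite has_find size_iota.
move=> /(nth_find 0%N); rewrite -/(dist u v) nth_iota // add0n.
by move=> /existsP[q qP]; exists q; rewrite ?size_tuple.
Qed.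

Lemma is_path_rev u v p : is_path u v p -> is_path v u (rev (belast u p)).
Proof.
case/and3P => pP /eqP <- pU; apply/and3P; split.
- by rewrite rev_path (eq_path (e' := @adj G)) // => x y; apply: adj_sym.
- by case: p {pP pU} => [|x p] //=; rewrite rev_cons last_rcons.
- by rewrite -rev_rcons -lastI rev_uniq.
Qed.

Lemma dist_sym u v :
  connect (@adj G) u v -> connect (@adj G) v u -> dist u v = dist v u.
Proof.
move=> uv vu; apply/eqP; rewrite eqn_leq; apply/andP; split.
  have [p <- /is_path_rev/dist_le] := shortest_path_exists vu.
  by rewrite size_rev size_belast.
have [p <- /is_path_rev/dist_le] := shortest_path_exists uv.
by rewrite size_rev size_belast.
Qed.

Lemma dist_gt0 u v : connect (@adj G) u v -> u != v -> (0 < dist u v)%N.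
Proof.
move=> /shortest_path_exists[p <-]; case: p => [|//].
by case/and3P => _ /= ->.
Qed.

Lemma dist_adj u v : adj u v -> dist u v = 1%N.
Proof.
move=> uv; have neq : u != v by apply: contraL uv => /eqP->; rewrite adj_irrefl.
apply/eqP; rewrite eqn_leq dist_gt0 ?connect1 // andbT.
by apply: (@dist_le _ _ [:: v]); rewrite /is_path /= uv eqxx inE neq.
Qed.

End ShortestPaths.

(** * Switching functions *)

Lemma not_uniq_split (T : eqType) (s : seq T) : ~~ uniq s ->
  exists x s1 s2 s3, s = s1 ++ x :: s2 ++ x :: s3.
Proof.
elim: s => //= x s IHs; rewrite negb_and negbK => /orP[/splitPr[s2 s3] | /IHs].
  by exists x, [::], s2, s3.
by case=> y [s1 [s2 [s3 ->]]]; exists y, (x :: s1), s2, s3.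
Qed.

Section Switching.
Variable S : signed_graph.
Implicit Types (u v : S) (p : seq S).

Lemma path_sign_cat u p q :
  path_sign u (p ++ q) = path_sign u p * path_sign (last u p) q.
Proof. by rewrite /path_sign pairmap_cat big_cat. Qed.

Lemma path_sign_cons u x p :
  path_sign u (x :: p) = sign [set u; x] * path_sign x p.
Proof. by rewrite /path_sign big_cons. Qed.

Lemma path_sign1 u x : path_sign u [:: x] = sign [set u; x].
Proof. by rewrite path_sign_cons /path_sign big_nil mulr1. Qed.

(** The reversal of the walk u :: p starts at [last u p] and continues with
    [rev (belast u p)]; edges are unordered pairs, so its sign is the same. *)
Lemma path_sign_rev u p :
  path_sign (last u p) (rev (belast u p)) = path_sign u p.
Proof.
elim: p u => [|x p IHp] u //=.
rewrite rev_cons -cats1 path_sign_cat IHp (path_sign_cons u) mulrC; congr (_ * _).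
suff -> : last (last x p) (rev (belast x p)) = x by rewrite path_sign1 setUC.
by case: p {IHp} => [|y p] //=; rewrite rev_cons last_rcons.
Qed.

Lemma edge_sign_sqr u v : adj u v -> sign [set u; v] * sign [set u; v] = 1.
Proof.
move=> uv; have /signP : [set u; v] \in edges S.
  by apply/imsetP; exists (u, v); rewrite ?inE.
by case/orP => /eqP ->.
Qed.

(** Switching the signs at the vertices where theta is -1 makes all edges
    positive; equivalently, the negative edges are the cut between the two
    level sets of theta. *)
Definition switching (theta : S -> int) : Prop :=
  (forall v, theta v * theta v = 1) /\
  (forall u v, adj u v -> sign [set u; v] = theta u * theta v).

Lemma switching_path_sign theta u p : switching theta ->
  path (@adj S) u p -> path_sign u p = theta u * theta (last u p).
Proof.
move=> [sq edgeE]; elim: p u => [|x p IHp] u /=.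
  by rewrite /path_sign big_nil sq.
case/andP => ux xp; rewrite path_sign_cons IHp // edgeE //.
by rewrite mulrA -(mulrA (theta u)) sq mulr1.
Qed.

(** A closed walk that repeats a vertex splits there into two shorter closed
    walks, and the sign is multiplicative.  One that does not is a cycle, or
    trivial, or runs along one edge back and forth and has a square as sign. *)
Lemma balanced_closed_walk u p : balanced S ->
  path (@adj S) u p -> last u p = u -> path_sign u p = 1.
Proof.
move=> bal; have [n] := ubnP (size p).
elim: n u p => // n IHn u p; rewrite ltnS => le_n pP pu.
have [pU | ] := boolP (uniq p).
  case/lastP: p le_n pP pu pU => [|q v]; first by rewrite /path_sign big_nil.
  rewrite last_rcons => _ pP vu pU; move: pP pU; rewrite vu => pP pU.
  (* u :: q is a cycle as soon as it has at least three vertices *)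
  have [gt1 | ] := ltnP 1 (size q).
    apply: (bal (u :: q)); rewrite /is_cycle /= ltnS gt1 /ucycleb /= pP /=.
    by rewrite -rcons_uniq.
  case: q pP {pU} => [|x [|//]] /=.
    by rewrite adj_irrefl.
  case/and3P => ux _ _ _; rewrite path_sign_cons path_sign1.
  by rewrite [[set x; u]]setUC edge_sign_sqr.
case/not_uniq_split => x [p1 [p2 [p3 def_p]]]; move: le_n pP pu; rewrite {}def_p.
rewrite -cat_rcons -[p2 ++ _]cat_rcons !cat_path !last_cat !last_rcons.
rewrite !size_cat !size_rcons => le_n /and3P[p1P p2P p3P] p3u.
rewrite !path_sign_cat !last_rcons (IHn x) ?last_rcons //; last first.
  by apply: leq_trans le_n; rewrite size_rcons addSn ltnS addnCA leq_addr.
rewrite mul1r -[in path_sign x p3](last_rcons u p1 x) -path_sign_cat; apply: IHn.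
- apply: leq_trans le_n; rewrite size_cat size_rcons ltn_add2l.
  by rewrite addSn ltnS leq_addl.
- by rewrite cat_path p1P last_rcons.
- by rewrite last_cat last_rcons.
Qed.

(** Harary's criterion.  Define theta v as the sign of an arbitrary walk from
    a root r to v: the closed walk made of the walk to u, the edge uv and the
    walk back from v is positive, which is the switching equation at uv. *)
Lemma balancedP : connected_graph S ->
  balanced S <-> exists theta, switching theta.
Proof.
case=> /card_gt0P[r _] S_conn; split=> [bal | [theta thetaP] [|x p] //]; last first.
  case/and3P=> _ /= cP _.
  by rewrite (switching_path_sign thetaP cP) last_rcons; case: thetaP.
have walkP v : exists p, path (@adj S) r p && (last r p == v).
  by have /connectP[p pP ->] := S_conn r v; exists p; rewrite pP /=.
pose w v := xchoose (walkP v).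
have wP v : path (@adj S) r (w v) by have /andP[] := xchooseP (walkP v).
have w_last v : last r (w v) = v by have /andP[_ /eqP] := xchooseP (walkP v).
have path_sqr u p : path (@adj S) u p -> path_sign u p * path_sign u p = 1.
  elim: p u => [|x p IHp] u /=; first by rewrite /path_sign big_nil.
  case/andP => ux xp; rewrite path_sign_cons mulrACA IHp // edge_sign_sqr //.
exists (fun v => path_sign r (w v)); split=> [v | u v uv]; first exact: path_sqr.
have : path_sign r (w u ++ v :: rev (belast r (w v))) = 1.
  apply: balanced_closed_walk => //.
    rewrite cat_path wP w_last /= uv -{1}(w_last v) rev_path.
    by rewrite (eq_path (e' := @adj S)) ?wP // => x y; apply: adj_sym.
  rewrite last_cat /=; case: (w v) (w_last v) => [|x p] //=.
  by rewrite rev_cons last_rcons.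
rewrite path_sign_cat w_last path_sign_cons -{2}(w_last v) path_sign_rev.
set a := path_sign r (w u); set b := path_sign r (w v) => abs1.
have a2 : a * a = 1 by apply: path_sqr.
have b2 : b * b = 1 by apply: path_sqr.
by rewrite -[LHS]mul1r -a2 -[LHS]mulr1 -b2 -mulrA -[RHS]mulr1 -abs1; ring.
Qed.

Lemma all_shortest_paths_have_signP s u v :
  reflect (forall p, size p = dist u v -> is_path u v p -> path_sign u p = s)
          (all_shortest_paths_have_sign s u v).
Proof.
apply: (iffP forallP) => [allS p szp pP | allS p].
  have /implyP/= := allS (tcast szp (in_tuple p)).
  by rewrite val_tcast => /(_ pP)/eqP.
by apply/implyP => pP; apply/eqP/allS; rewrite ?size_tuple.
Qed.

(** As some shortest path exists, the vacuous case of the two universal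
    conditions that define sigma_max and sigma_min does not occur. *)
Lemma sigma_of_shortest_paths s u v : s * s = 1 -> connect (@adj S) u v ->
  (forall p, size p = dist u v -> is_path u v p -> path_sign u p = s) ->
  sigma_max u v = s /\ sigma_min u v = s.
Proof.
move=> s2 /shortest_path_exists[p szp pP] allS.
have all_eq t : all_shortest_paths_have_sign t u v = (t == s).
  apply/all_shortest_paths_have_signP/eqP => [allt | -> //].
  by rewrite -(allt p szp pP) (allS p szp pP).
rewrite /sigma_max /sigma_min !all_eq.
have : s ^+ 2 == 1 by rewrite expr2 s2.
by rewrite sqrf_eq1 => /orP[] /eqP ->.
Qed.

Lemma switching_sigma theta u v : switching theta -> connect (@adj S) u v ->
  sigma_max u v = theta u * theta v /\ sigma_min u v = theta u * theta v.
Proof.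
move=> thetaP uv; have [sq _] := thetaP; apply: sigma_of_shortest_paths => //.
  by rewrite mulrACA !sq.
by move=> p _ /and3P[pP /eqP <- _]; apply: switching_path_sign.
Qed.

Lemma adj_sigma u v : adj u v ->
  sigma_max u v = sign [set u; v] /\ sigma_min u v = sign [set u; v].
Proof.
move=> uv; apply: sigma_of_shortest_paths; rewrite ?edge_sign_sqr ?connect1 //.
rewrite (dist_adj uv) => -[|x [|y p]] // _ /and3P[_ /eqP <- _].
by rewrite path_sign1.
Qed.

Lemma sigma_sqr u v :
  sigma_max u v * sigma_max u v = 1 /\ sigma_min u v * sigma_min u v = 1.
Proof. by rewrite /sigma_max /sigma_min; split; case: ifP. Qed.

End Switching.

(** * Real symmetric matrices *)

Section RealSymmetric.
Variables (R : rcfType) (n : nat).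
Implicit Types (A M : 'M[R]_n) (x : 'rV[R]_n) (r s : R).
Local Notation C := R[i].
Local Notation toC := (map_mx (real_complex R)).

Lemma map_real_complex_realmx m p (B : 'M[R]_(m, p)) : toC B \is a realmx.
Proof. by apply/mxOverP => i j; rewrite mxE; apply/complex_realP; exists (B i j). Qed.

(** The spectral theorem over R[i], with the fact that the eigenvalues of a
    Hermitian matrix are real recorded in the type of l. *)
Lemma symmetric_spectral A : A^T = A ->
  exists (P : 'M[C]_n) (l : 'rV[R]_n), P \is unitarymx /\
    P *m toC A = diag_mx (toC l) *m P.
Proof.
move=> symA; have herm : toC A \is hermsymmx.
  apply: realsym_hermsym; last exact: map_real_complex_realmx.
  by apply/is_hermitianmxP; rewrite expr0 scale1r map_mx_id // map_trmx symA.
have unitP := spectral_unitarymx (toC A).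
exists (spectralmx (toC A)), (map_mx (@complex.Re R) (spectral_diag (toC A))).
split => //; have /orthomx_spectralP := hermitian_normalmx herm.
set P := spectralmx _; set l := spectral_diag _ => ->; rewrite -!mulmxA mulKVmx ?unitarymx_unit //.
congr (diag_mx _ *m _); apply/rowP => j; rewrite !mxE RRe_real //.
by apply/mxOverP/hermitian_spectral_diag_real.
Qed.

Lemma eigenvalue_real_complex A s :
  eigenvalue (toC A) s%:C = eigenvalue A s.
Proof.
by rewrite !eigenvalue_root_char -map_char_poly fmorph_root.
Qed.

Lemma eigenvalue_diagonalized A (P : 'M[C]_n) (l : 'rV[R]_n) s :
  P \in unitmx -> P *m toC A = diag_mx (toC l) *m P ->
  eigenvalue A s <-> exists i, s = l 0 i.
Proof.
move=> P_unit diagC; rewrite -eigenvalue_real_complex.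
split=> [/eigenvalueP[v vA v0] | [i ->]].
  pose w := v *m invmx P.
  have wP : w *m P = v by rewrite /w mulmxKV.
  have wl : w *m diag_mx (toC l) = s%:C *: w.
    by rewrite [RHS]scalemxAl -vA -wP -(mulmxA w) diagC mulmxA mulmxK.
  have : w != 0 by apply: contraNneq v0 => w0; rewrite -wP w0 mul0mx.
  case/rV0Pn => i wi0; exists i; apply: (@complexI R).
  have /rowP/(_ i) := wl; rewrite mul_mx_diag [LHS]mxE [RHS]mxE mulrC.
  by move=> /(mulIf wi0); rewrite mxE => ->.
apply/eigenvalueP; exists (row i P).
  by rewrite -row_mul diagC row_mul row_diag_mx mxE -scalemxAl -rowE.
apply: contraTneq P_unit => Pi0; rewrite -row_free_unit.
by apply/row_freePn; exists i; rewrite Pi0 sub0mx.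
Qed.

(** In the coordinates y of x in a unitary eigenbasis, r |x|^2 - x A x^T is the
    sum of the nonnegative terms (r - l i) |y i|^2.  The hypothesis makes it
    nonpositive, so each term vanishes and y i is zero unless l i = r. *)
Lemma rayleigh_equality A r x : A^T = A ->
  (forall s, eigenvalue A s -> s <= r) ->
  r * (x *m x^T) 0 0 <= (x *m A *m x^T) 0 0 -> x *m A = r *: x.
Proof.
move=> /symmetric_spectral[P [l [unitP diagP]]] r_max le_r.
have PPt : P *m P ^t* = 1%:M by apply/unitarymxP.
have PtP : P ^t* *m P = 1%:M by apply: mulmx1C.
have defA : toC A = P ^t* *m diag_mx (toC l) *m P.
  by rewrite -mulmxA -diagP mulmxA PtP mul1mx.
have l_le i : l 0 i <= r.
  apply: r_max; apply/(eigenvalue_diagonalized _ (unitarymx_unit unitP) diagP).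
  by exists i.
pose y := toC x *m P ^t*.
have yP : y *m P = toC x by rewrite -mulmxA PtP mulmx1.
have yt : y ^t* = P *m toC x^T.
  rewrite trmx_mul map_mxM trmxCK map_trmx realmxC //.
  exact: map_real_complex_realmx.
have sum0 : \sum_i (r - l 0 i)%:C * `|y 0 i| ^+ 2 = 0.
  apply/eqP; rewrite eq_le; apply/andP; split; last first.
    apply: sumr_ge0 => i _; rewrite mulr_ge0 ?exprn_ge0 //.
    by rewrite ler0c subr_ge0.
  have -> : \sum_i (r - l 0 i)%:C * `|y 0 i| ^+ 2
     = (r * (x *m x^T) 0 0 - (x *m A *m x^T) 0 0)%:C.
    rewrite rmorphB rmorphM /=.
    have -> : ((x *m x^T) 0 0)%:C = (y *m y ^t*) 0 0.
      by rewrite yt mulmxA yP -map_mxM [RHS]mxE.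
    have -> : ((x *m A *m x^T) 0 0)%:C = (y *m diag_mx (toC l) *m y ^t*) 0 0.
      rewrite yt /y !mulmxA -(mulmxA (toC x)) -(mulmxA (toC x)) -defA.
      by rewrite -!map_mxM [RHS]mxE.
    rewrite !mxE mulr_sumr -sumrB; apply: eq_bigr => i _.
    rewrite mul_mx_diag !mxE rmorphB normCK /=; ring.
  by rewrite lecR subr_le0.
have y0 i : (l 0 i)%:C * y 0 i = r%:C * y 0 i.
  have : (r - l 0 i)%:C * `|y 0 i| ^+ 2 == 0.
    apply/eqP; apply: (psumr_eq0P _ sum0) => // j _.
    by rewrite mulr_ge0 ?exprn_ge0 // ler0c subr_ge0.
  rewrite mulf_eq0 sqrf_eq0 normr_eq0 => /orP[|/eqP ->]; last by rewrite !mulr0.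
  by rewrite fmorph_eq0 subr_eq0 => /eqP ->.
apply: (@map_mx_inj _ _ (real_complex R)).
rewrite map_mxM map_mxZ /= -yP defA !mulmxA -(mulmxA y) PPt mulmx1.
rewrite scalemxAl; congr (_ *m _); apply/rowP => i.
by rewrite mul_mx_diag [LHS]mxE [RHS]mxE -y0 mulrC; congr (_ * _); rewrite mxE.
Qed.

Lemma symmetric_largest_eigenvalue A : (0 < n)%N -> A^T = A ->
  exists2 r, eigenvalue A r & forall s, eigenvalue A s -> s <= r.
Proof.
move=> n_gt0 /symmetric_spectral[P [l [/unitarymx_unit unitP diagP]]].
have eigP s := eigenvalue_diagonalized s unitP diagP.
have [i _ l_max] := arg_maxP (fun i => l 0 i) (erefl : xpredT (Ordinal n_gt0)).
by exists (l 0 i) => [|s /eigP[j ->]]; [apply/eigP; exists i | apply: l_max].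
Qed.

End RealSymmetric.

(** * Matrices dominated by a positive symmetric matrix *)

Section Perron.
Variables (R : rcfType) (n : nat).
Implicit Types (A M : 'M[R]_n) (x : 'rV[R]_n) (r s : R).

Lemma quadratic_formE A x :
  (x *m A *m x^T) 0 0 = \sum_(ij : 'I_n * 'I_n) x 0 ij.1 * A ij.1 ij.2 * x 0 ij.2.
Proof.
transitivity (\sum_j \sum_i x 0 i * A i j * x 0 j).
  by rewrite mxE; apply: eq_bigr => j _; rewrite !mxE mulr_suml.
by rewrite exchange_big pair_big.
Qed.

(** The equality case of the comparison of the spectra of M and A >= |M|: M is
    A conjugated by the diagonal matrix of the signs of an eigenvector.  The
    diagonal of A is only known to be nonnegative, but in order n > 1 the
    positive off-diagonal entries already make A irreducible. *)
Lemma max_eigenvalue_signature A M r : A^T = A ->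
  (forall i j, i != j -> 0 < A i j) -> (forall i j, `|M i j| <= A i j) ->
  (forall s, eigenvalue A s -> s <= r) -> eigenvalue M r ->
  exists theta : 'I_n -> int, (forall i, theta i * theta i = 1) /\
    forall i j, M i j = (theta i * theta j)%:~R * A i j.
Proof.
move=> symA A_gt0 le_MA r_max /eigenvalueP[x xM x0].
pose y := map_mx Num.norm x.
have le_term (ij : 'I_n * 'I_n) : x 0 ij.1 * M ij.1 ij.2 * x 0 ij.2
    <= y 0 ij.1 * A ij.1 ij.2 * y 0 ij.2.
  rewrite !mxE; apply: le_trans (ler_norm _) _.
  by rewrite !normrM ler_wpM2r // ler_wpM2l.
have yy : (y *m y^T) 0 0 = (x *m x^T) 0 0.
  by rewrite !mxE; apply: eq_bigr => i _; rewrite !mxE -normrM ger0_norm ?sqr_ge0.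
have le_xy : (x *m M *m x^T) 0 0 <= (y *m A *m y^T) 0 0.
  by rewrite !quadratic_formE; apply: ler_sum.
have xMx : (x *m M *m x^T) 0 0 = r * (y *m y^T) 0 0.
  by rewrite yy xM -scalemxAl mxE.
have yA : y *m A = r *: y by apply: rayleigh_equality; rewrite // -xMx.
(* if x i = 0, the i-th entry of y *m A = r *: y is a vanishing sum of
   nonnegative terms, which kills all the other entries of x *)
have x_neq0 i : x 0 i != 0.
  apply: contraNneq x0 => xi0; apply/eqP/rowP => j; rewrite mxE.
  have [-> // | ji] := eqVneq j i.
  have /rowP/(_ i) := yA; rewrite !mxE xi0 normr0 mulr0 => sum0.
  have : y 0 j * A j i = 0.
    apply: (psumr_eq0P _ sum0) => // k _.
    by rewrite !mxE mulr_ge0 // (le_trans _ (le_MA k i)).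
  by move/eqP; rewrite mxE mulf_eq0 normr_eq0 (gt_eqF (A_gt0 _ _ ji)) orbF => /eqP.
have eq_term i j : x 0 i * M i j * x 0 j = y 0 i * A i j * y 0 j.
  have sum0 : \sum_(ij : 'I_n * 'I_n) (y 0 ij.1 * A ij.1 ij.2 * y 0 ij.2
      - x 0 ij.1 * M ij.1 ij.2 * x 0 ij.2) = 0.
    by rewrite sumrB -!quadratic_formE xMx yA -scalemxAl mxE subrr.
  apply/eqP; rewrite eq_sym -subr_eq0; apply/eqP.
  by apply: (psumr_eq0P _ sum0 (i := (i, j))) => // ij _; rewrite subr_ge0.
exists (fun i => sgz (x 0 i)); split=> [i | i j].
  by rewrite -sgzM sgz_def mulf_neq0 // -expr2 ltNge sqr_ge0.
have sg2 k : Num.sg (x 0 k) * Num.sg (x 0 k) = 1 by rewrite -expr2 sqr_sg x_neq0.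
rewrite rmorphM /= -!sgrEz.
have := eq_term i j; rewrite !mxE => eq_ij.
have nz : `|x 0 i| * `|x 0 j| != 0 by rewrite mulf_neq0 ?normr_eq0.
apply: (mulfI nz).
transitivity (Num.sg (x 0 i) * Num.sg (x 0 j) * (x 0 i * M i j * x 0 j)).
  by rewrite !normrEsg; ring.
by rewrite eq_ij; ring.
Qed.

End Perron.

(** * Cospectral matrices *)

Section Cospectrality.
Variables (R : realType) (n : nat).
Implicit Types A B : 'M[R]_n.

Lemma eigenvalue_mult A (s : R) : eigenvalue A s = (0 < eigen_mult A s%:C)%N.
Proof.
rewrite -eigenvalue_real_complex eigenvalue_root_char root_factor_theorem.
by rewrite XsubC_dvd // monic_neq0 ?char_poly_monic.
Qed.

(** The symmetric matrix B has a largest eigenvalue, and cospectral matrices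
    have the same real eigenvalues. *)
Lemma cospectral_same_largest A B : (0 < n)%N -> B^T = B ->
  cospectral A B -> same_largest_eigenvalue A B.
Proof.
move=> n_gt0 symB AB; have [r rB r_max] := symmetric_largest_eigenvalue n_gt0 symB.
have eqAB s : eigenvalue A s = eigenvalue B s by rewrite !eigenvalue_mult AB.
by exists r; split; split; rewrite ?eqAB // => s; rewrite ?eqAB; apply: r_max.
Qed.

(** The matrix is T A T for the diagonal matrix T of theta, and T is its own
    inverse. *)
Lemma signature_cospectral A (theta : 'I_n -> int) :
  (forall i, theta i * theta i = 1) ->
  cospectral (\matrix_(i, j) ((theta i * theta j)%:~R * A i j)) A.
Proof.
move=> theta2 z; congr (mup z _); rewrite -!map_char_poly; congr map_poly.
pose T : 'M[R]_n := diag_mx (\row_i (theta i)%:~R).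
have TT : T *m T = 1%:M.
  rewrite mulmx_diag; apply/matrixP => i j; rewrite !mxE -rmorphM /= theta2.
  by rewrite rmorph1.
have -> : (\matrix_(i, j) ((theta i * theta j)%:~R * A i j)) = T *m A *m T.
  apply/matrixP => i j; rewrite mul_mx_diag mul_diag_mx !mxE rmorphM /=; ring.
have charE : char_poly_mx (T *m A *m T)
    = map_mx polyC T *m char_poly_mx A *m map_mx polyC T.
  rewrite /char_poly_mx mulmxBr mulmxBl !map_mxM; congr (_ - _).
  by rewrite mul_mx_scalar -scalemxAl -map_mxM TT map_mx1 scalemx1.
rewrite /char_poly charE !det_mulmx mulrAC -det_mulmx -map_mxM TT map_mx1.
by rewrite det1 mul1r.
Qed.

End Cospectrality.

(** * Signed distance matrices *)

Section SignedDistance.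
Variables (R : realType) (S : signed_graph).
Hypothesis S_connected : connected_graph S.

Let conn (u v : S) : connect (@adj S) u v.
Proof. by case: S_connected. Qed.

Lemma D_sym : (D R S)^T = D R S.
Proof. by apply/matrixP => i j; rewrite !mxE dist_sym. Qed.

Lemma balanced_Dpm : balanced S ->
  cospectral (Dmax R S) (D R S) /\ Dmax R S = Dmin R S.
Proof.
case/(balancedP S_connected) => theta thetaP; have [sq _] := thetaP.
pose f (i : 'I_#|S|) : int := theta (enum_val i).
have E (i j : 'I_#|S|) := switching_sigma thetaP (conn (enum_val i) (enum_val j)).
split.
  have -> : Dmax R S = \matrix_(i, j) ((f i * f j)%:~R * D R S i j).
    by apply/matrixP => i j; rewrite !mxE /d_max (E i j).1 rmorphM.
  by apply: signature_cospectral => i; apply: sq.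
by apply/matrixP => i j; rewrite !mxE /d_max /d_min (E i j).1 (E i j).2.
Qed.

(** Stated for an arbitrary choice of signs sigma that agrees with the signature
    on the edges, so that it serves for both sigma_max and sigma_min. *)
Lemma same_largest_balanced (M : 'M[R]_#|S|) (sigma : S -> S -> int) :
  (forall u v, sigma u v * sigma u v = 1) ->
  (forall u v, adj u v -> sigma u v = sign [set u; v]) ->
  M = \matrix_(i, j) (sigma (enum_val i) (enum_val j) *
                      (dist (enum_val i) (enum_val j))%:Z)%:~R ->
  same_largest_eigenvalue M (D R S) -> balanced S.
Proof.
move=> sigma2 sigma_adj defM [r [[rM _] [_ r_max]]]; apply/(balancedP S_connected).
have norm1 (a : int) : a * a = 1 -> `|a| = 1.
  by move/eqP; rewrite -expr2 sqrf_eq1 => /orP[] /eqP ->.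
have [|| theta [sq thetaE]] := max_eigenvalue_signature D_sym _ _ r_max rM.
- move=> i j ij; rewrite mxE ltr0n dist_gt0 //.
  by apply: contraNneq ij => /enum_val_inj ->.
- move=> i j; rewrite defM !mxE rmorphM normrM /= normr_nat -intr_norm.
  by have /norm1 -> := sigma2 (enum_val i) (enum_val j); rewrite mul1r.
exists (theta \o enum_rank); split=> [v | u v uv] /=; first exact: sq.
have := thetaE (enum_rank u) (enum_rank v).
rewrite defM !mxE !enum_rankK dist_adj // mulr1 sigma_adj // mulr1.
by move/intr_inj.
Qed.

End SignedDistance.

Theorem theorem3p5 (R : realType) (S : signed_graph)
    (S_connected : connected_graph S) :
  [<-> balanced S;
       cospectral (Dmax R S) (D R S);
       cospectral (Dmin R S) (D R S);
       same_largest_eigenvalue (Dmax R S) (D R S);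
       same_largest_eigenvalue (Dmin R S) (D R S)]
  /\ (balanced S <->
      exists M : 'M[R]_#|S|, is_Dpm M /\ cospectral M (D R S)).
Proof.
have cosp_largest M : cospectral M (D R S) -> same_largest_eigenvalue M (D R S).
  by apply: cospectral_same_largest (D_sym _ _); case: S_connected.
have max_bal : same_largest_eigenvalue (Dmax R S) (D R S) -> balanced S.
  apply: (@same_largest_balanced _ _ _ _ (@sigma_max S)) => //.
    by move=> u v; case: (sigma_sqr u v).
  by move=> u v /adj_sigma[].
have min_bal : same_largest_eigenvalue (Dmin R S) (D R S) -> balanced S.
  apply: (@same_largest_balanced _ _ _ _ (@sigma_min S)) => //.
    by move=> u v; case: (sigma_sqr u v).
  by move=> u v /adj_sigma[].
have bal_max b := (balanced_Dpm R S_connected b).1.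
have bal_eq b := (balanced_Dpm R S_connected b).2.
split; last first.
  split=> [b | [M [[-> _] /cosp_largest/max_bal]]] //.
  by exists (Dmax R S); split; [split; rewrite ?bal_eq | apply: bal_max].
tfae=> [/bal_max // | cM | /cosp_largest/min_bal/bal_max/cosp_largest //
       | lM | /min_bal //].
  by rewrite -bal_eq //; apply/max_bal/cosp_largest.
by rewrite -bal_eq //; apply: max_bal.
Qed.
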